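(* Let $q=2^m$ where $m\ge 3$. Let $\mathcal{P}=\mathrm{GF}(q)$, $B_2=\{u\in\mathrm{GF}(q):\mathrm{Tr}(u^3-u)=1\}$ and $\mathcal{B}_2=\{g(B_2):g\in\mathrm{GA}_1(q)\}$, where $\mathrm{GA}_1(q)=\{x\mapsto ax+b:a\in\mathrm{GF}(q)^*,b\in\mathrm{GF}(q)\}$. Then $(\mathcal{P},\mathcal{B}_2)$ is a $2$-$(2^m,k,\lambda)$ design, where $$k=\begin{cases}2^{m-1}-\left(\frac{2}{m}\right)2^{(m-1)/2} & \text{if } m\equiv 1\pmod 2,\\ 2^{m-1}+2^{m/2+1} & \text{if } m\equiv 0\pmod 4,\\ 2^{m-1} & \text{if } m\equiv 2\pmod 4,\end{cases}\qquad \lambda=\begin{cases}k(k-1)/2 & \text{if } m\not\equiv 0\pmod 4,\\ k(k-1)/12 & \text{if } m\equiv 0\pmod 4,\end{cases}$$ and $\left(\frac{2}{m}\right)$ is the Jacobi symbol.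
   Context: $\mathrm{Tr}$ denotes the absolute trace from $\mathrm{GF}(2^m)$ to $\mathrm{GF}(2)$. A $t$-$(v,k,\lambda)$ design is a pair $(\mathcal{P},\mathcal{B})$ with $|\mathcal{P}|=v$ and $\mathcal{B}$ a set of $k$-subsets of $\mathcal{P}$ such that every $t$-subset of $\mathcal{P}$ lies in exactly $\lambda$ members of $\mathcal{B}$.
   Formalization: For m ≡ 0 (mod 4) the printed k = 2^{m-1}+2^{m/2+1} is false (for m = 4 it gives k = 16 = q, but 0 is not in B_2); the formal statement uses the correct k = 2^{m-1}+(-1)^{m/4}2^{m/2}, with λ = k(k-1)/12 for this k. *)

(* Defs.v *)
From mathcomp Require Import all_boot all_order all_algebra.

Set Implicit Arguments.
Unset Strict Implicit.
Unset Printing Implicit Defensive.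

Import GRing.Theory Num.Theory.

Local Open Scope ring_scope.

Definition is_design (T : finType) (t v k lambda : nat)
    (P : {set T}) (Bs : {set {set T}}) : Prop :=
  [/\ #|P| = v,
      forall B : {set T}, B \in Bs -> B \subset P /\ #|B| = k
    & forall S : {set T}, S \subset P -> #|S| = t ->
        #|[set B in Bs | S \subset B]| = lambda].

(* On a field of order 2 ^ m this is the sum of the conjugates of x over the
   prime field GF(2), which is identified with {0, 1} inside F. *)
Definition abs_trace (F : finFieldType) (m : nat) (x : F) : F :=
  \sum_(i < m) x ^+ (2 ^ i).

Definition GA1 (F : finFieldType) : {set {ffun F -> F}} :=
  [set g | [exists a : F, exists b : F,
     (a != 0) && (g == [ffun x => a * x + b])]].

Definition B2 (F : finFieldType) (m : nat) : {set F} :=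
  [set u : F | abs_trace m (u ^+ 3 - u) == 1].

Definition blocks2 (F : finFieldType) (m : nat) : {set {set F}} :=
  [set [set g u | u in B2 F m] | g : {ffun F -> F} in GA1 F].

(* Meaningful for an odd prime p. *)
Definition legendre (a : int) (p : nat) : int :=
  if (p%:Z %| a)%Z then 0
  else if [exists x : 'I_p, (x%:Z ^+ 2 == a %[mod p%:Z])%Z] then 1
  else -1.

(* Meaningful for odd n > 0; prime_decomp lists the pairs (p, e) of primes
   dividing n with their multiplicities. *)
Definition jacobi (a : int) (n : nat) : int :=
  \prod_(pe <- prime_decomp n) legendre a pe.1 ^+ pe.2.

(* The case 4 %| m follows from the curve y^2 + y = x^3 + x, whose Frobenius
   eigenvalues over GF(2) are -1 + i and -1 - i: the sum of (-1)^Tr(u^3 - u)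
   over GF(2^m) is then - (-1)^(m/4) * 2^(m/2 + 1). The sign cannot be dropped:
   the block size is 4 for m = 4, 144 for m = 8 and 1984 for m = 12. *)
Definition block_size (m : nat) : int :=
  if (m %% 2 == 1)%N then 2 ^+ m.-1 - jacobi 2 m * 2 ^+ (m.-1 %/ 2)%N
  else if (m %% 4 == 0)%N then 2 ^+ m.-1 + (-1) ^+ (m %/ 4)%N * 2 ^+ (m %/ 2)%N
  else 2 ^+ m.-1.

Definition design_lambda (m k : nat) : rat :=
  if (m %% 4 == 0)%N then k%:R * (k%:R - 1) / 12%:R
  else k%:R * (k%:R - 1) / 2%:R.

(* Main.v *)
Require Import Defs.
From mathcomp Require Import all_boot all_order all_fingroup all_algebra.
From mathcomp Require Import all_solvable all_field.
From mathcomp Require Import ring zify.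

(* The blocks are the orbit of B_2 under the sharply 2-transitive group GA_1(q),
   so counting triples (pair of points, group element) gives
   lambda * |Stab B_2| = k (k - 1) and everything reduces to k and the stabilizer.

   Write Q(x) = Tr(x^3 + x), a quadratic form with
   Q(x + y) = Q(x) + Q(y) + Tr((x^4 + x) y^2), and S = sum (-1)^Q(x) = q - 2k.
   Polarizing Q(a x + d) = Q(x) shows that the stabilizer consists of the (a, d)
   with a^3 = 1, d^4 + d = 1 + a and Q(d) = 0; it has 12 elements if 4 | m, and is
   {x, x + 1} otherwise.  Squaring S leaves only the radical {w : w^4 = w}, hence
   S^2 = 2q for m odd, 0 for m = 2 mod 4, and 4q for 4 | m.  The sign of S comes
   from counting fixed points of a permutation of prime order preserving Q: for m
   odd, the Frobenius x |-> x^(2^n) of order p on GF(2^(p n)) gives S_(pn) = S_n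
   mod p, whence the factor 2^((p-1)/2) = (2/p) for each prime p dividing m; for
   4 | m, an affine map of order 3 with a single fixed point x0, where
   x0^4 + x0 = 1, gives S mod 3. *)

Set Implicit Arguments.
Unset Strict Implicit.
Unset Printing Implicit Defensive.

Import GRing.Theory Num.Theory.

Local Open Scope ring_scope.

(** * Fixed points modulo p and Euler's criterion for 2 *)

(** Extended by the identity outside [S], [f] is a permutation whose [p]-th power is 1, so its
    orbits on [S] have size 1 or [p]. *)
Lemma card_fixpoints_mod (T : finType) (p : nat) (S : {set T}) (f : T -> T) :
  prime p -> {in S, forall x, f x \in S} ->
  {in S, forall x, iter p f x = x} ->
  #|S| = #|[set x in S | f x == x]| %[mod p].
Proof.
move=> p_pr fS fp; pose g x := if x \in S then f x else x.
have gp x : iter p g x = x.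
  have [xS|xS] := boolP (x \in S); last first.
    by apply: iter_fix; rewrite /g (negPf xS).
  have gS j : iter j g x = iter j f x /\ iter j f x \in S.
    elim: j => [|j [IH1 IH2]] //=.
    by rewrite IH1 /g IH2 fS.
  by rewrite (gS p).1 fp.
have g_inj : injective g.
  by move=> x y gxy; rewrite -(gp x) -(gp y) -(prednK (prime_gt0 p_pr)) !iterSr gxy.
pose s := perm g_inj.
have sp : (s ^+ p)%g = 1%g.
  apply/permP=> x; rewrite permX perm1 -[RHS]gp.
  by apply: eq_iter => y; rewrite permE.
have pS : (p.-group <[s]>)%g.
  rewrite /pgroup -orderE; apply: pnat_dvd (pnat_id p_pr).
  by rewrite order_dvdn sp.
have actS : [acts <[s]>%g, on S | 'P].
  rewrite cycle_subG; apply/astabsP => x.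
  rewrite /= apermE permE /g; case: ifP => [xS|->] //.
  by rewrite fS ?xS.
rewrite (pgroup_fix_mod pS actS); congr (_ %% _)%N; apply: eq_card => x.
rewrite afix_cycle !inE; case xS: (x \in S) => //=.
by rewrite sub1set inE /= apermE permE /g xS.
Qed.

(** With a product over all primes below a common bound, the symbols of [n] and [p * n] can be
    compared factor by factor. *)
Lemma jacobi_prod (a : int) (n N : nat) : (0 < n < N)%N ->
  jacobi a n = \prod_(0 <= p < N | prime p) legendre a p ^+ logn p n.
Proof.
move=> /andP[n0 nN]; rewrite /jacobi prime_decompE big_map /=.
rewrite [RHS](bigID (fun p => p \in primes n)) /=.
rewrite [X in _ * X]big1 ?mulr1; last first.
  move=> p /andP[p_pr]; rewrite mem_primes p_pr n0 /= => pn.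
  by rewrite lognE (negPf pn) !andbF.
rewrite -[RHS]big_filter; apply: perm_big; apply: uniq_perm; rewrite ?primes_uniq //.
  by rewrite filter_uniq // iota_uniq.
move=> p; rewrite mem_filter mem_index_iota /= mem_primes.
case: (prime p) => //=; rewrite n0 /=.
by case pn: (p %| n)%N => //=; rewrite (leq_ltn_trans (dvdn_leq _ pn)).
Qed.

Lemma jacobiM (a : int) (p n : nat) : prime p -> (0 < n)%N ->
  jacobi a (p * n) = legendre a p * jacobi a n.
Proof.
move=> p_pr n0; have p0 := prime_gt0 p_pr.
have pn0 : (0 < p * n)%N by rewrite muln_gt0 p0.
pose N := (p * n).+1.
have hp : (0 < p < N)%N by rewrite p0 ltnS leq_pmulr.
rewrite (@jacobi_prod _ (p * n) N) ?pn0 ?ltnSn // (@jacobi_prod _ n N); last first.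
  by rewrite n0 ltnS leq_pmull.
under eq_bigr do rewrite lognM // exprD.
rewrite big_split /= -(@jacobi_prod a p N) //; congr (_ * _).
by rewrite /jacobi prime_decompE primes_prime //= big_seq1 /= logn_prime // eqxx expr1.
Qed.

(** Euler's criterion for 2: it turns the powers of 2 that arise modulo [p] into Legendre
    symbols. *)
Lemma legendre2_Fp (p : nat) : prime p -> odd p ->
  (legendre 2 p)%:~R = 2%:R ^+ p.-1./2 :> 'F_p.
Proof.
move=> p_pr p_odd; have p_gt2 : (2 < p)%N by apply: odd_prime_gt2.
have pF : p \in [pchar 'F_p] by apply: pchar_Fp.
have two0 : (2%:R : 'F_p) != 0.
  by rewrite -(dvdn_pcharf pF) gtnNdvd.
have dvdE (z : int) : (p%:Z %| z)%Z = (z%:~R == 0 :> 'F_p).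
  case: z => z; first by rewrite dvdzE /= (dvdn_pcharf pF).
  by rewrite dvdzE NegzE abszN /= (dvdn_pcharf pF) mulrNz oppr_eq0.
have half : (p.-1./2 + p.-1./2 = p.-1)%N.
  rewrite addnn halfK; case: p p_odd {p_pr p_gt2 pF two0 dvdE} => //= p.
  by case: odd; rewrite ?subn0.
have cardF := card_Fp p_pr.
have fermat (x : 'F_p) : x != 0 -> x ^+ p.-1 = 1.
  move=> x0; apply: (mulfI x0); rewrite mulr1 -exprS prednK ?prime_gt0 //.
  by rewrite -[X in x ^+ X]cardF expf_card.
rewrite /legendre dvdE (negPf two0).
case: ifP => [/existsP[x]|nsq].
  rewrite eqz_mod_dvd dvdE rmorphB rmorphXn /= subr_eq0 => /eqP h2.
  rewrite -[2%:R]h2 -exprM mul2n -addnn half fermat //.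
  by apply: contra_neq two0 => x0; rewrite -[2%:R]h2 x0 expr0n.
(* For a non-square the power is 1 or -1. If it were 1, writing 2 as g^i for a generator g would
   make i even, hence 2 a square. *)
have : (2%:R ^+ p.-1./2 : 'F_p) ^+ 2 == 1 by rewrite -exprM muln2 -addnn half fermat.
rewrite sqrf_eq1 => /orP[] /eqP h; last by rewrite h.
have twoU : (2%:R : 'F_p) \is a GRing.unit by rewrite unitfE.
have /cyclicP[g gE] := field_unit_group_cyclic [set: {unit 'F_p}]%G.
have : FinRing.unit 'F_p twoU \in <[g]>%g by rewrite -gE inE.
case/cycleP => i /(congr1 val) /= gi.
have og : #[g]%g = p.-1 by rewrite orderE -gE card_finField_unit cardF.
have : (g ^+ (i * p.-1./2))%g == 1%g.
  rewrite expgM; apply/eqP/val_inj; rewrite /= FinRing.val_unitX /=.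
  by rewrite -gi h.
rewrite -order_dvdn og -{1}half addnn -muln2 mulnC dvdn_pmul2r; last first.
  by rewrite half_gt0; lia.
rewrite dvdn2 => evi.
exfalso; move/negbT/negP: nsq; apply; apply/existsP.
pose y : 'F_p := val g ^+ i./2.
have yp : (y < p)%N by rewrite -[X in (_ < X)%N](Fp_cast p_pr) ltn_ord.
exists (Ordinal yp); rewrite /= eqz_mod_dvd dvdE rmorphB rmorphXn /= subr_eq0.
have -> : ((y : nat)%:Z)%:~R = y by rewrite -pmulrn natr_Zp.
rewrite /y -exprM muln2 halfK (negPf evi) subn0.
by apply/eqP; rewrite -FinRing.val_unitX -[LHS]gi.
Qed.

(** * Traces and the cubic form in characteristic 2 *)

Section Char2.

Variables (F : finFieldType) (char2 : 2%N \in [pchar F]).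

(* Brings identities of characteristic 2 within reach of [ring]: [c] is the
   quotient of [a - b] by 2 computed over the integers. *)
Lemma eq_char2 (a b c : F) : a - b = 2%:R * c -> a = b.
Proof. by rewrite pcharf0 // mul0r => /subr0_eq. Qed.

Lemma exprD_char2 i (x y : F) : (x + y) ^+ (2 ^ i) = x ^+ (2 ^ i) + y ^+ (2 ^ i).
Proof. by apply: exprDn_pchar; rewrite pnatX pnatE ?char2. Qed.

Lemma abs_traceD n (x y : F) : abs_trace n (x + y) = abs_trace n x + abs_trace n y.
Proof. by rewrite -big_split; apply: eq_bigr => i _; apply: exprD_char2. Qed.

Lemma abs_trace0 n : abs_trace n (0 : F) = 0.
Proof. by apply: big1 => i _; rewrite expr0n expn_eq0. Qed.

(** This is the subfield GF(2^n) when n > 0 divides the degree of [F]. It is kept as a subset of [F]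
    so that sums over different subfields share one type. *)
Definition frob_fix n : {set F} := [set x | x ^+ (2 ^ n) == x].
Local Notation K := frob_fix.

Lemma frob_fixP n x : reflect (x ^+ (2 ^ n) = x) (x \in K n).
Proof. by rewrite inE; apply: eqP. Qed.

Lemma frob_fix_mul n j x : x \in K n -> x \in K (j * n).
Proof.
move/frob_fixP=> xK; apply/frob_fixP; elim: j => [|j IH]; first by rewrite expr1.
by rewrite mulSn expnD exprM xK.
Qed.

Lemma frob_fixD n x y : x \in K n -> y \in K n -> x + y \in K n.
Proof. by rewrite !inE exprD_char2 => /eqP-> /eqP->. Qed.
Lemma frob_fixM n x y : x \in K n -> y \in K n -> x * y \in K n.
Proof. by rewrite !inE exprMn => /eqP-> /eqP->. Qed.
Lemma frob_fixX n x j : x \in K n -> x ^+ j \in K n.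
Proof. by rewrite !inE exprAC => /eqP->. Qed.
Lemma frob_fixV n x : x \in K n -> x^-1 \in K n.
Proof. by rewrite !inE exprVn => /eqP->. Qed.

(** Squaring permutes the conjugates cyclically. *)
Lemma abs_trace_sqr n (x : F) : x \in K n -> abs_trace n (x ^+ 2) = abs_trace n x.
Proof.
move/frob_fixP=> xK; rewrite /abs_trace.
under eq_bigr do rewrite -exprM -expnS.
case: n xK => [|n] xK; first by rewrite !big_ord0.
by rewrite big_ord_recr big_ord_recl /= xK expr1 addrC.
Qed.

Lemma sqr_abs_trace n (x : F) : (abs_trace n x) ^+ 2 = abs_trace n (x ^+ 2).
Proof.
rewrite /abs_trace; elim: n => [|n IH]; first by rewrite !big_ord0 expr0n.
by rewrite !big_ord_recr /= (exprD_char2 1) IH -!exprM mulnC.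
Qed.

Lemma abs_trace01 n (x : F) : x \in K n -> (abs_trace n x == 0) || (abs_trace n x == 1).
Proof.
move=> xK; rewrite -[_ == 1]subr_eq0 -mulf_eq0 mulrBr mulr1 -expr2 sqr_abs_trace.
by rewrite abs_trace_sqr // subrr.
Qed.

(** The conjugates of [x] repeat with period [n], so their sum is taken [d] times. *)
Lemma abs_trace_mul d n x : x \in K n -> abs_trace (d * n) x = d%:R * abs_trace n x.
Proof.
move/frob_fixP => xK; elim: d => [|d IH]; first by rewrite mul0r /abs_trace big_ord0.
rewrite mulSn /abs_trace big_split_ord /= -/(abs_trace n x).
under [X in _ + X]eq_bigr do rewrite expnD exprM xK.
by rewrite -/(abs_trace (d * n) x) IH -natr1 mulrDl mul1r addrC.
Qed.

(** Upper bound: the elements are roots of X^(2^n) - X. Lower bound: with q the order of [F] and d =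
    2^n - 1, all elements outside [K n] are roots of R = (X^(q-1) - 1) / (X^d - 1), of degree q -
    2^n. *)
Lemma card_frob_fix m n : (0 < n)%N -> (n %| m)%N -> #|F| = (2 ^ m)%N ->
  #|K n| = (2 ^ n)%N.
Proof.
move=> n0 /dvdnP[j ->] cF.
have n20 : (0 < 2 ^ n)%N by rewrite expn_gt0.
apply/eqP; rewrite eqn_leq; apply/andP; split.
  have sz : size ('X^(2 ^ n) - 'X : {poly F}) = (2 ^ n).+1.
    by rewrite size_polyDl ?size_polyXn // size_polyN size_polyX ltnS
       (leq_ltn_trans n0 (ltn_expl n _)).
  rewrite cardE -ltnS -sz; apply: max_poly_roots; rewrite ?enum_uniq //.
    by rewrite -size_poly_eq0 sz.
  by apply/allP=> x; rewrite mem_enum inE rootE !hornerE subr_eq0.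
pose d := (2 ^ n).-1.
have [k] : exists k, (2 ^ (j * n)).-1 = (d * k)%N.
  by rewrite mulnC expnM predn_exp; eexists.
have F1 : (1 < #|F|)%N by apply: finNzRing_gt1.
rewrite -cF => dk.
have k0 : (0 < k)%N.
  rewrite lt0n; apply: contraTneq F1 => k0.
  by rewrite -leqNgt -subn_eq0 subn1 dk k0 muln0.
have d0 : (0 < d)%N.
  rewrite lt0n; apply: contraTneq F1 => d0.
  by rewrite -leqNgt -subn_eq0 subn1 dk d0 mul0n.
pose R : {poly F} := \sum_(i < k) ('X^d) ^+ i.
have PR : ('X^d - 1) * R = 'X^(d * k) - 1 by rewrite exprM [RHS]subrX1.
have szXn e : (0 < e)%N -> size ('X^e - 1 : {poly F}) = e.+1.
  by move=> e0; rewrite size_XnsubC.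
have Xn0 e : (0 < e)%N -> 'X^e - 1 != 0 :> {poly F}.
  by move=> e0; rewrite -size_poly_eq0 szXn.
have dk0 : (0 < d * k)%N by rewrite muln_gt0 d0.
have R0 : R != 0 by apply: contraTneq (Xn0 _ dk0) => R0; rewrite -PR R0 mulr0 eqxx.
have szR : (size R + d = (d * k).+1)%N.
  by rewrite -szXn // -PR size_mul ?Xn0 // szXn // addSn addnC.
have : (size (enum (~: K n)) < size R)%N.
  apply: max_poly_roots; rewrite ?enum_uniq //.
  apply/allP => x; rewrite mem_enum !inE => xK.
  have x0 : x != 0 by apply: contraNneq xK => ->; rewrite expr0n expn_eq0.
  have xd : x ^+ d != 1.
    by apply: contraNneq xK => xd; rewrite -(prednK n20) exprS xd mulr1.
  have := congr1 (fun p : {poly F} => p.[x]) PR.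
  rewrite /= !hornerE -dk => /eqP.
  have -> : x ^+ #|F|.-1 = 1.
    by apply: (mulfI x0); rewrite -exprS prednK ?expf_card ?mulr1 //; lia.
  by rewrite subrr mulf_eq0 subr_eq0 (negPf xd).
rewrite -cardE -(cardsC (K n)) in dk F1 *; lia.
Qed.

Lemma add01_char2 (t u : F) : (t == 0) || (t == 1) -> (u == 0) || (u == 1) ->
  (t + u == 0) || (t + u == 1).
Proof.
by move=> /orP[]/eqP-> /orP[]/eqP->; rewrite ?addrr_pchar2 // ?addr0 ?add0r eqxx ?orbT.
Qed.

(** The sign (-1)^t of a bit t of GF(2) inside [F]; arguments outside GF(2) get the default -1. *)
Definition chi (t : F) : int := if t == 0 then 1 else -1.

Lemma chiD (t u : F) : (t == 0) || (t == 1) -> (u == 0) || (u == 1) ->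
  chi (t + u) = chi t * chi u.
Proof.
rewrite /chi => /orP[] /eqP-> /orP[] /eqP->.
- by rewrite addr0 eqxx.
- by rewrite add0r eqxx oner_eq0.
- by rewrite addr0 eqxx oner_eq0.
- by rewrite addrr_pchar2 // eqxx oner_eq0.
Qed.

Lemma chi_sqr (t : F) : chi t * chi t = 1.
Proof. by rewrite /chi; case: eqP. Qed.

Definition cubic n (x : F) : F := abs_trace n (x ^+ 3 - x).

Lemma cubicE n x : cubic n x = abs_trace n (x ^+ 3) + abs_trace n x.
Proof. by rewrite /cubic -abs_traceD oppr_pchar2. Qed.

Lemma cubic01 n x : x \in K n -> (cubic n x == 0) || (cubic n x == 1).
Proof.
by move=> xK; apply: abs_trace01; rewrite oppr_pchar2 // frob_fixD ?frob_fixX.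
Qed.

(** The cube contributes the cross terms x^2 y + x y^2; under the trace the first may be squared,
    which leaves a form linear in y^2. *)
Lemma cubicD n x y : x \in K n -> y \in K n ->
  cubic n (x + y) = cubic n x + cubic n y + abs_trace n ((x ^+ 4 + x) * y ^+ 2).
Proof.
move=> xK yK; rewrite !cubicE.
have -> : (x + y) ^+ 3 = x ^+ 3 + y ^+ 3 + (x ^+ 2 * y + x * y ^+ 2).
  by apply: (@eq_char2 _ _ (x ^+ 2 * y + x * y ^+ 2)); ring.
have -> : (x ^+ 4 + x) * y ^+ 2 = (x ^+ 2 * y) ^+ 2 + x * y ^+ 2 by ring.
rewrite !abs_traceD abs_trace_sqr ?frob_fixM ?frob_fixX //; ring.
Qed.

Lemma sum_frob_fix_shift n (f : F -> int) y : y \in K n ->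
  \sum_(x in K n) f x = \sum_(x in K n) f (x + y).
Proof.
move=> yK; rewrite (reindex_inj (addIr y)); apply: eq_bigl => x /=.
apply/idP/idP=> h; last exact: frob_fixD.
by rewrite -(addrK_pchar2 char2 y x) frob_fixD.
Qed.

(** * Character sums over a subfield *)

Section CharSum.

Variables (n : nat) (n_gt0 : (0 < n)%N) (cardK : #|K n| = (2 ^ n)%N).

(** The trace polynomial has degree 2^(n-1), so it cannot vanish on all 2^n elements of [K n], where
    its only values are 0 and 1. *)
Lemma exists_abs_trace1 : exists2 x, x \in K n & abs_trace n x = 1.
Proof.
pose P j : {poly F} := \sum_(i < j) 'X^(2 ^ i).
have szP j : (size (P j) <= 2 ^ j)%N.
  elim: j => [|j IH]; first by rewrite /P big_ord0 size_poly0.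
  rewrite /P big_ord_recr /= (leq_trans (size_polyD _ _)) // size_polyXn geq_max.
  rewrite (leq_trans IH) ?leq_exp2l // expnS mul2n -addnn -addn1 leq_add2l.
  by rewrite expn_gt0.
case: n n_gt0 cardK => // k _ cK.
have szPk : size (P k.+1) = (2 ^ k).+1.
  by rewrite /P big_ord_recr /= addrC size_polyDl size_polyXn // ltnS szP.
case: (pickP [pred x | (x \in K k.+1) && (abs_trace k.+1 x == 1)]) => [x|noX].
  by case/andP=> xK /eqP; exists x.
suff : (size (enum (K k.+1)) < size (P k.+1))%N.
  rewrite -cardE cK szPk ltnS leq_exp2l //; lia.
apply: max_poly_roots; rewrite ?enum_uniq -?size_poly_eq0 ?szPk //.
apply/allP=> x; rewrite mem_enum => xK; rewrite rootE /P horner_sum.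
under eq_bigr do rewrite hornerXn.
have := noX x; have := abs_trace01 xK; rewrite /= xK /= => /orP[|->] //.
Qed.

Lemma abs_trace_nondeg (c : F) : c \in K n -> c != 0 ->
  exists2 y, y \in K n & abs_trace n (c * y) = 1.
Proof.
move=> cK c0; have [x xK x1] := exists_abs_trace1.
by exists (c^-1 * x); rewrite ?frob_fixM ?frob_fixV // mulVKf.
Qed.

Lemma frob_fix_sqrt (c : F) : c \in K n -> exists2 d, d \in K n & d ^+ 2 = c.
Proof.
move=> cK; exists (c ^+ (2 ^ n.-1)); first exact: frob_fixX.
by rewrite -exprM -expnSr prednK //; apply/frob_fixP.
Qed.

Lemma sum_chi_sqr (c : F) : c \in K n ->
  \sum_(y in K n) chi (abs_trace n (c * y ^+ 2)) = if c == 0 then 2 ^+ n else 0.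
Proof.
move=> cK; case: eqP => [->|/eqP c0].
  under eq_bigr do rewrite mul0r abs_trace0 /chi eqxx.
  by rewrite sumr_const cardK natrX.
have [d dK dc] := frob_fix_sqrt cK.
have d0 : d != 0 by apply: contraNneq c0 => d0; rewrite -dc d0 expr0n.
have [z zK z1] := abs_trace_nondeg dK d0.
(* Translation by [z], where Tr(d z) = 1, changes the sign of every term, so the sum is its own
   opposite. *)
set S := LHS; suff : S = - S by move=> h; lia.
rewrite {1}/S (sum_frob_fix_shift _ zK) -sumrN; apply: eq_bigr => y yK.
rewrite (exprD_char2 1) mulrDr abs_traceD chiD; first last.
- by rewrite abs_trace01 ?frob_fixM ?frob_fixX.
- by rewrite abs_trace01 ?frob_fixM ?frob_fixX.
rewrite -{2}dc -exprMn abs_trace_sqr ?frob_fixM // z1 {2}/chi oner_eq0.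
by rewrite mulrN1.
Qed.

Definition cubic_sum : int := \sum_(x in K n) chi (cubic n x).

(** Substituting x = y + w in one factor makes the signs of Q(y) cancel; the remaining sum over y
    vanishes unless w lies in the radical, that is w^4 = w. *)
Lemma cubic_sum_sqr :
  cubic_sum ^+ 2 = 2 ^+ n * \sum_(w in K n | w ^+ 4 == w) chi (cubic n w).
Proof.
rewrite expr2 {1}/cubic_sum mulr_suml.
transitivity (\sum_(y in K n) \sum_(w in K n)
   chi (cubic n w) * chi (abs_trace n ((w ^+ 4 + w) * y ^+ 2))).
  apply: eq_bigr => y yK; rewrite /cubic_sum (sum_frob_fix_shift _ yK) mulr_sumr.
  apply: eq_bigr => w wK; rewrite cubicD // !chiD ?cubic01 //; first last.
  - by rewrite abs_trace01 // frob_fixM ?frob_fixD ?frob_fixX.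
  - by rewrite add01_char2 ?cubic01.
  by rewrite [X in _ * (X * _)]mulrC !mulrA chi_sqr mul1r.
rewrite exchange_big /= big_mkcondr /= mulr_sumr; apply: eq_bigr => w wK.
rewrite -mulr_sumr sum_chi_sqr ?frob_fixD ?frob_fixX //.
by rewrite addr_eq0 oppr_pchar2 //; case: eqP; rewrite ?mulr0 // mulrC.
Qed.

End CharSum.

End Char2.

(** * The character sum for odd exponents *)

Section Odd.

Variables (F : finFieldType) (char2 : 2%N \in [pchar F]).
Local Notation K := (@frob_fix F).

Lemma natr_char2 d : (d%:R : F) = (odd d)%:R.
Proof. by rewrite -(GRing.natr_mod_pchar char2) modn2. Qed.

Lemma cubic_mul d n (x : F) : x \in K n -> cubic (d * n) x = d%:R * cubic n x.
Proof.
by move=> xK; apply: abs_trace_mul; rewrite oppr_pchar2 // frob_fixD ?frob_fixX.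
Qed.

Lemma cubic_0 n : cubic n (0 : F) = 0.
Proof. by rewrite /cubic expr0n subr0 abs_trace0. Qed.

Lemma cubic_1 n : cubic n (1 : F) = 0.
Proof. by rewrite /cubic expr1n subrr abs_trace0. Qed.

Lemma cubic_sum_count n : #|K n| = (2 ^ n)%N ->
  cubic_sum F n = 2 ^+ n - (#|[set x in K n | cubic n x == 1]|)%:Z *+ 2.
Proof.
move=> cK.
have -> : cubic_sum F n = \sum_(x in K n) (1 - ((cubic n x == 1) : nat)%:R *+ 2).
  apply: eq_bigr => x xK; rewrite /chi.
  by case/orP: (cubic01 char2 xK) => /eqP->; rewrite ?eqxx ?oner_eq0 // eq_sym oner_eq0.
rewrite sumrB sumr_const cK natrX sumrMnl; congr (_ - _ *+ 2).
rewrite -natz -sum1_card -natr_sum; congr (_%:R).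
rewrite big_mkcond [RHS]big_mkcond /=; apply: eq_bigr => x _.
by rewrite !inE; case: eqP => //=; case: (_ == 1).
Qed.

(** Since n - 1 is even, w^4 = w gives w^(2^(n-1)) = w, hence w = w^(2^n) = w^2. *)
Lemma frob_fix4_odd n (w : F) : odd n -> w \in K n -> w ^+ 4 = w -> (w == 0) || (w == 1).
Proof.
move=> on /frob_fixP wK w4.
have wj j : w ^+ (2 ^ (j * 2)) = w.
  by apply/frob_fixP; apply: frob_fix_mul; apply/frob_fixP.
have : w ^+ 2 = w.
  by rewrite -{2}wK -(odd_double_half n) on -muln2 expnD mulnC exprM wj.
by move=> w2; rewrite -[_ == 1]subr_eq0 -mulf_eq0 mulrBr mulr1 -expr2 w2 subrr.
Qed.

Lemma cubic_sum_odd_sqr n : odd n -> #|K n| = (2 ^ n)%N -> cubic_sum F n ^+ 2 = 2 ^+ n.+1.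
Proof.
move=> on cK; have n0 : (0 < n)%N by case: (n) on.
rewrite (cubic_sum_sqr char2 n0 cK) exprSr; congr (_ * _).
rewrite (eq_bigl (mem [set (0 : F); 1])); last first.
  move=> w; rewrite !inE; apply/andP/idP => [[wK /eqP w4]|].
    by apply: (@frob_fix4_odd n); rewrite ?inE.
  by case/orP => /eqP->; rewrite ?expr0n ?expr1n ?expn_eq0 ?eqxx.
by rewrite big_setU1 ?inE 1?eq_sym ?oner_eq0 //= big_set1 cubic_0 cubic_1 /chi eqxx.
Qed.

(** The map x -> x^(2^n) permutes the elements of GF(2^(pn)) with Q = 1, and its [p]-th iterate is
    the identity. Its fixed points are the elements of GF(2^n) with Q = 1, since the two forms agree
    there for odd p. *)
Lemma cubic_sum_mod (p n : nat) : prime p -> odd p ->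
  #|K n| = (2 ^ n)%N -> #|K (p * n)| = (2 ^ (p * n))%N ->
  (cubic_sum F (p * n))%:~R = (cubic_sum F n)%:~R :> 'F_p.
Proof.
move=> p_pr p_odd cKn cKpn.
rewrite !cubic_sum_count // !rmorphB !rmorphMn !rmorphXn /=.
have frob (x : 'F_p) : x ^+ p = x by rewrite -[X in x ^+ X](card_Fp p_pr) expf_card.
congr (_ - _ *+ 2); first by rewrite exprM frob.
have pF := pchar_Fp p_pr.
rewrite -!pmulrn -[LHS](GRing.natr_mod_pchar pF) -[RHS](GRing.natr_mod_pchar pF).
congr (_%:R); set S := [set _ in _ | _].
pose f (x : F) := x ^+ (2 ^ n).
have iterf j x : iter j f x = x ^+ (2 ^ (j * n)).
  by elim: j => [|j IH]; rewrite ?expr1 //= IH /f -exprM -expnD addnC mulSn.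
(* Invariance is checked one squaring at a time. *)
have TF x : x \in K (p * n) -> cubic (p * n) (f x) = cubic (p * n) x.
  rewrite /f => xK; elim: {2}n => [|j IH]; first by rewrite expr1.
  rewrite -IH expnSr exprM; move: (x ^+ _) (frob_fixX (2 ^ j) xK) => y yK.
  by rewrite !cubicE // [(y ^+ _) ^+ 3]exprAC !abs_trace_sqr ?frob_fixX.
rewrite (@card_fixpoints_mod _ p S f) //; last 2 first.
- by move=> x; rewrite !inE => /andP[xK xQ]; rewrite TF ?inE // xQ andbT -exprAC (eqP xK).
- by move=> x; rewrite inE => /andP[/frob_fixP xK _]; rewrite iterf.
congr (_ %% _)%N; apply: eq_card => x; rewrite !inE.
case: (eqVneq (x ^+ (2 ^ n)) x) => [xn|xn]; last by rewrite andbF.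
have xK : x \in K n by apply/frob_fixP.
have := frob_fix_mul p xK; rewrite inE => ->; rewrite andbT /=.
by rewrite cubic_mul // natr_char2 p_odd mul1r.
Qed.

End Odd.

(** Either a = b or a = -b; in the second case 2b would vanish modulo p, while b^2 is a power of the
    unit 2. A residue thus decides the sign. *)
Lemma eq_of_sqr_eq_mod (p e : nat) (a b : int) : (2%:R : 'F_p) != 0 ->
  a ^+ 2 = 2 ^+ e -> b ^+ 2 = 2 ^+ e -> a%:~R = b%:~R :> 'F_p -> a = b.
Proof.
move=> two0 a2 b2 ab.
have : a ^+ 2 == b ^+ 2 by rewrite a2 b2.
rewrite eqf_sqr => /orP[/eqP//|/eqP aN].
have b0 : (b%:~R : 'F_p) != 0.
  have : (2%:R : 'F_p) ^+ e != 0 by rewrite expf_neq0.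
  apply: contra_neq => b0; have := congr1 (intr : int -> 'F_p) b2.
  by rewrite !rmorphXn /= b0 expr0n.
have : (2%:R * b%:~R : 'F_p) == 0.
  by rewrite mulr_natl mulr2n -{1}ab aN rmorphN addNr.
by rewrite mulf_eq0 (negPf two0) (negPf b0).
Qed.

(** Induction splits off a prime p from n = p k: both sides have square 2^(n+1), and they agree
    modulo p. *)
Lemma cubic_sum_odd (F : finFieldType) (m n : nat) : #|F| = (2 ^ m)%N ->
  odd n -> (n %| m)%N -> cubic_sum F n = jacobi 2 n * 2 ^+ n.+1./2.
Proof.
move=> cF; have char2 : 2%N \in [pchar F] by apply: card_finPcharP cF _.
elim/ltn_ind: n => n IH on nm.
have n0 : (0 < n)%N by case: (n) on.
have cK j : odd j -> (j %| m)%N -> #|frob_fix F j| = (2 ^ j)%N.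
  by move=> oj jm; apply: card_frob_fix jm cF => //; case: (j) oj.
(* Base case: on GF(2) the form is zero and the sum is 2. *)
have [n1|n1] := leqP n 1.
  have {n1 n0} nE : n = 1%N by apply/eqP; rewrite eqn_leq n1.
  rewrite nE in on nm *; rewrite cubic_sum_count ?cK // /jacobi big_nil mul1r.
  rewrite (_ : [set x in _ | _] = set0) ?cards0 ?subr0 //.
  apply/setP => x; rewrite !inE; apply/andP => -[/eqP x2].
  by rewrite /cubic /abs_trace big_ord1 expr1 exprSr x2 -expr2 x2 subrr eq_sym oner_eq0.
pose p := pdiv n; have p_pr : prime p by apply: pdiv_prime.
have /dvdnP[k nE] : (p %| n)%N by apply: pdiv_dvd.
rewrite mulnC in nE.
move: on; rewrite nE oddM => /andP[op ok].
have p_gt2 : (2 < p)%N by apply: odd_prime_gt2.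
have two0 : (2%:R : 'F_p) != 0.
  by rewrite -(dvdn_pcharf (pchar_Fp p_pr)) gtnNdvd.
have km : (k %| m)%N by apply: dvdn_trans nm; rewrite nE dvdn_mull.
have k0 : (0 < k)%N by case: (k) ok.
have kn : (k < n)%N by rewrite nE ltn_Pmull // prime_gt1.
have IHk := IH k kn ok km.
have sqk := cubic_sum_odd_sqr char2 ok (cK k ok km).
rewrite nE in nm.
have sqn := cubic_sum_odd_sqr char2 (n := p * k) _ (cK (p * k)%N _ nm).
have opk : odd (p * k) by rewrite oddM op.
have half2 j : odd j -> (j.+1./2 * 2 = j.+1)%N.
  by move=> oj; rewrite muln2 halfK /= oj subn0.
have J2 : jacobi 2 k ^+ 2 = 1.
  move: sqk; rewrite IHk exprMn -exprM half2 // -[RHS]mul1r.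
  by apply: mulIf; rewrite expf_neq0.
have Lmod := legendre2_Fp p_pr op.
have L2 : legendre 2 p ^+ 2 = 1.
  rewrite /legendre dvdzE /= gtnNdvd //.
  by case: ifP; rewrite ?expr1n ?sqrrN ?expr1n.
apply: (@eq_of_sqr_eq_mod p (p * k).+1) => //.
- exact: sqn.
- by rewrite jacobiM // !exprMn L2 J2 -exprM half2 // !mul1r.
rewrite cubic_sum_mod ?cK // IHk jacobiM // !rmorphM !rmorphXn /= Lmod.
(* The extra power of 2 is E^k with E = 2^((p-1)/2). As E^2 = 1 modulo p and k is odd, E^k = E
   cancels the E that comes from [Lmod]. *)
have -> : (uphalf (p * k) = uphalf k + p.-1./2 * k)%N.
  have p0 : (0 < p)%N by apply: prime_gt0.
  have h1 := half2 _ opk; have h2 := half2 _ ok.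
  have h3 : (p.-1./2 * 2 = p.-1)%N.
    by rewrite muln2 halfK -[p.-1]subn1 oddB // op subn0.
  apply/eqP; rewrite -(eqn_pmul2r (isT : 0 < 2)%N) mulnDl.
  rewrite -[uphalf k]/(k.+1./2) -[uphalf _]/((p * k).+1./2).
  by rewrite h1 h2 mulnAC h3 -{1}(prednK p0) mulSn addSn.
rewrite exprD exprM.
have E2 : (2%:R ^+ p.-1./2 : 'F_p) ^+ 2 = 1 by rewrite -Lmod -rmorphXn L2.
set E := 2%:R ^+ p.-1./2 in E2 *.
have Ek : E ^+ k = E.
  by rewrite -(odd_double_half k) ok -mul2n exprD exprM E2 expr1n mulr1.
by rewrite Ek [X in _ = _ * X]mulrC mulrACA -expr2 E2 mul1r.
Qed.

(** * The character sum for even exponents *)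

Lemma exists_unity_root (F : finFieldType) (p : nat) : prime p -> (p %| #|F|.-1)%N ->
  exists2 z : F, z ^+ p = 1 & z != 1.
Proof.
rewrite -card_finField_unit => p_pr /(Cauchy p_pr)[u _ ou].
exists (val u); first by rewrite -FinRing.val_unitX -ou expg_order.
apply: contraTneq (prime_gt1 p_pr) => u1.
by rewrite -ou (_ : u = 1%g) ?order1 //; apply: val_inj.
Qed.

Section Even.

Variables (F : finFieldType) (m : nat) (cF : #|F| = (2 ^ m)%N).

Lemma char2_of_card : 2%N \in [pchar F].
Proof. exact: card_finPcharP cF _. Qed.
Let char2 := char2_of_card.

Local Notation K := (@frob_fix F).

Lemma mem_frob_fix (x : F) : x \in K m.
Proof. by rewrite inE -cF expf_card. Qed.

Lemma card_frob_fixT : #|K m| = (2 ^ m)%N.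
Proof. by rewrite -cF; apply: eq_card => x; rewrite mem_frob_fix. Qed.

(** For m even, 3 divides 2^m - 1, so there is a primitive cube root of unity, a root of x^2 + x +
    1. *)
Lemma exists_cube_root : ~~ odd m -> exists tau : F, tau ^+ 2 = tau + 1.
Proof.
move=> em; have [||z z3 z1] := @exists_unity_root F 3 => //.
  rewrite cF -(odd_double_half m) (negPf em) add0n -muln2 mulnC expnM.
  exact: (dvdn_pred_predX 4).
exists z; have : (z - 1) * (z ^+ 2 - (z + 1)) == 0.
  apply/eqP/(@eq_char2 _ char2 _ _ (1 - z ^+ 2)).
  rewrite subr0 (_ : 2%:R * _ = (z ^+ 3 - 1) + 2%:R * (1 - z ^+ 2)); last by rewrite z3; ring.
  by ring.
by rewrite mulf_eq0 !subr_eq0 (negPf z1) => /eqP.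
Qed.

Section CubeRoot.

Variables (tau : F) (tau2 : tau ^+ 2 = tau + 1).

Lemma cube_root3 : tau ^+ 3 = 1.
Proof.
rewrite exprS tau2 mulrDr mulr1 -expr2 tau2.
by apply: (@eq_char2 _ char2 _ _ tau); ring.
Qed.

Lemma cube_root_neq0 : tau != 0.
Proof. by apply: contra_eq_neq tau2 => ->; rewrite expr0n add0r eq_sym oner_eq0. Qed.

Lemma cube_root_neq1 : tau != 1.
Proof.
apply: contra_eq_neq tau2 => ->; rewrite expr1n addrr_pchar2 //.
exact: oner_neq0.
Qed.

Lemma gf4E : [set w : F | w ^+ 4 == w] = [set 0; 1; tau; tau + 1].
Proof.
apply/setP=> w; rewrite !inE -subr_eq0.
have -> : w ^+ 4 - w = w * (w - 1) * (w - tau) * (w - (tau + 1)).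
  have e : w * (w - 1) * (w - tau) * (w - (tau + 1)) =
    w * (w - 1) * (w ^+ 2 - w * (2%:R * tau + 1) + (tau ^+ 2 + tau)) by ring.
  rewrite e tau2 (_ : tau + 1 + tau = 2%:R * tau + 1); last by ring.
  rewrite pcharf0 // mul0r; apply: (@eq_char2 _ char2 _ _ (w ^+ 3 - w ^+ 2)); ring.
by rewrite !mulf_eq0 !subr_eq0.
Qed.

Lemma gf4_uniq : uniq [:: 0; 1; tau; tau + 1].
Proof.
have h0 : 0 == tau + 1 = false.
  by rewrite eq_sym addr_eq0 oppr_pchar2 // (negPf cube_root_neq1).
have h1 : 1 == tau + 1 = false.
  by rewrite -[X in X == _]add0r (inj_eq (addIr _)) eq_sym (negPf cube_root_neq0).
have h2 : tau == tau + 1 = false.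
  by rewrite -[X in X == _]addr0 (inj_eq (addrI _)) eq_sym oner_eq0.
rewrite /= !inE h0 h1 h2 !(eq_sym _ tau) eq_sym oner_eq0.
by rewrite (negPf cube_root_neq0) (negPf cube_root_neq1).
Qed.

Lemma card_gf4 : #|[set w : F | w ^+ 4 == w]| = 4.
Proof.
rewrite gf4E -[RHS](card_uniqP gf4_uniq); apply: eq_card => x.
by rewrite !inE -!orbA.
Qed.

(** Over GF(4), Tr(tau^3) = Tr(1) = 0 and Tr(tau) = tau + tau^2 = 1; passing to degree 2d multiplies
    the value by d. *)
Lemma cubic_cube_root d : m = (d * 2)%N -> cubic m tau = d%:R.
Proof.
move=> mE; have t4 : tau ^+ 4 = tau by rewrite exprS cube_root3 mulr1.
rewrite mE cubic_mul //; last by rewrite inE t4.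
rewrite [X in _ * X](_ : _ = 1) ?mulr1 //.
rewrite cubicE // /abs_trace !big_ord_recl !big_ord0 /=.
rewrite !expr1 !addr0 cube_root3 expr1n tau2.
by apply: (@eq_char2 _ char2 _ _ (tau + 1)); ring.
Qed.

End CubeRoot.

(** The radical is GF(4), on which Q takes the values 0, 0, d, d modulo 2. *)
Lemma cubic_sum_even_sqr d : (0 < d)%N -> m = (d * 2)%N ->
  cubic_sum F m ^+ 2 = 2 ^+ m * (if odd d then 0 else 4).
Proof.
move=> d0 mE; have m0 : (0 < m)%N by rewrite mE muln_gt0 d0.
have [tau tau2] : exists tau : F, tau ^+ 2 = tau + 1.
  by apply: exists_cube_root; rewrite mE oddM andbF.
rewrite (cubic_sum_sqr char2 m0 card_frob_fixT); congr (_ * _).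
rewrite (eq_bigl (mem [set w : F | w ^+ 4 == w])); last first.
  by move=> w; rewrite mem_frob_fix /= inE.
have tau2' : (tau + 1) ^+ 2 = (tau + 1) + 1.
  by rewrite (exprD_char2 char2 1) tau2 expr1n.
rewrite (gf4E tau2) (eq_bigl (mem [:: 0; 1; tau; tau + 1])); last first.
  by move=> w; rewrite !inE -!orbA.
rewrite -big_uniq ?(gf4_uniq tau2) //= !big_cons big_nil cubic_0 cubic_1.
rewrite (cubic_cube_root tau2 mE) (cubic_cube_root tau2' mE) natr_char2 // /chi eqxx.
by case: odd; rewrite ?eqxx ?oner_eq0.
Qed.

Lemma exists_artin_schreier4 : (4 %| m)%N ->
  exists tau x0 : F, tau ^+ 2 = tau + 1 /\ x0 ^+ 4 = x0 + 1.
Proof.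
move=> /dvdnP[d mE]; have [||z z5 z1] := @exists_unity_root F 5 => //.
  rewrite cF mE mulnC expnM; apply: dvdn_trans (dvdn_pred_predX 16 _) => //.
have zS : 1 + z + z ^+ 2 + z ^+ 3 + z ^+ 4 = 0.
  have : (z - 1) * (1 + z + z ^+ 2 + z ^+ 3 + z ^+ 4) = z ^+ 5 - 1 by ring.
  by rewrite z5 subrr => /eqP; rewrite mulf_eq0 subr_eq0 (negPf z1) => /eqP.
(* As z is a primitive fifth root of unity, tau^2 = z^2 + z^3 = tau + 1. For x0 = tau^2 z one has
   x0^4 = tau^2 z^4, hence x0 + x0^4 = tau^3 = 1. *)
pose tau := z + z ^+ 4.
have tau2 : tau ^+ 2 = tau + 1.
  apply: (@eq_char2 _ char2 _ _ (z ^+ 5 - z - z ^+ 4 - 1)).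
  transitivity (z ^+ 2 + z ^+ 5 * z ^+ 3 - z - z ^+ 4 - 1 + 2%:R * z ^+ 5).
    by rewrite /tau; ring.
  transitivity ((1 + z + z ^+ 2 + z ^+ 3 + z ^+ 4) + 2%:R * (z ^+ 5 - z - z ^+ 4 - 1)).
    by rewrite z5; ring.
  by rewrite zS add0r.
exists tau, (tau ^+ 2 * z); split=> //.
have t3 := cube_root3 tau2.
have -> : (tau ^+ 2 * z) ^+ 4 = (tau ^+ 3) ^+ 2 * tau ^+ 2 * z ^+ 4 by ring.
rewrite t3 expr1n mul1r; apply: (@eq_char2 _ char2 _ _ (- (tau ^+ 2 * z))).
transitivity (tau ^+ 3 - 1 + 2%:R * - (tau ^+ 2 * z)); first by rewrite /tau; ring.
by rewrite t3 subrr add0r.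
Qed.

Lemma abs_trace4E (x : F) :
  abs_trace 4 x = (x + x ^+ 4) + (x + x ^+ 4) ^+ 2.
Proof.
rewrite /abs_trace !big_ord_recl big_ord0 /= (exprD_char2 char2 1) -exprM; ring.
Qed.

(** The fourth power adds e to x and fixes e, so applied twice it adds 2e = 0. *)
Lemma mem_gf16 (x e : F) : x ^+ 4 = x + e -> e ^+ 4 = e -> x \in K 4.
Proof.
move=> x4 e4; rewrite inE (_ : (2 ^ 4 = 4 * 4)%N) // exprM x4.
rewrite (exprD_char2 char2 2) x4 e4; apply/eqP.
by apply: (@eq_char2 _ char2 _ _ e); ring.
Qed.

(** Over GF(16), Tr(x) = 0 and Tr(x^3) = 1, so the form is 1 there; the parity of d = m/4 then
    decides whether x lies in the base block. *)
Lemma cubic_artin_schreier (d : nat) (x : F) : m = (d * 4)%N -> x ^+ 4 = x + 1 ->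
  cubic m x = d%:R.
Proof.
move=> mE x4; rewrite mE cubic_mul //; last by apply: mem_gf16 x4 _; rewrite expr1n.
rewrite [X in _ * X](_ : _ = 1) ?mulr1 //.
rewrite cubicE // !abs_trace4E [(x ^+ 3) ^+ 4]exprAC x4.
have -> : x + (x + 1) = 1 by apply: (@eq_char2 _ char2 _ _ x); ring.
have -> : x ^+ 3 + (x + 1) ^+ 3 = x ^+ 2 + x + 1.
  by apply: (@eq_char2 _ char2 _ _ (x ^+ 3 + x ^+ 2 + x)); ring.
have -> : (x ^+ 2 + x + 1) ^+ 2 = x + x ^+ 2.
  have -> : (x ^+ 2 + x + 1) ^+ 2 = x ^+ 4 + (2 * x ^+ 3 + 3 * x ^+ 2 + 2 * x + 1) by ring.
  by rewrite x4; apply: (@eq_char2 _ char2 _ _ (x ^+ 3 + x ^+ 2 + x + 1)); ring.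
by apply: (@eq_char2 _ char2 _ _ (x ^+ 2 + x + 1)); ring.
Qed.

(** For 4 | m the condition on the constant term of a stabilizing map is automatic: with e = 1 + a
    in GF(4), the traces over GF(16) are Tr(b) = e + e^2 and Tr(b^3) = e^3, and e + e^2 + e^3 =
    0. *)
Lemma cubic_stab_const (d : nat) (a b : F) : m = (d * 4)%N ->
  a ^+ 3 = 1 -> b ^+ 4 + b = 1 + a -> cubic m b = 0.
Proof.
move=> mE a3 b4; have {}b4 : b ^+ 4 = b + (1 + a).
  by rewrite -b4 addrCA addrr_pchar2 ?addr0.
have a4 : a ^+ 4 = a by rewrite exprS a3 mulr1.
have e4 : (1 + a) ^+ 4 = 1 + a by rewrite (exprD_char2 char2 2) a4 expr1n.
rewrite mE cubic_mul //; last by apply: mem_gf16 b4 e4.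
rewrite [X in _ * X](_ : _ = 0) ?mulr0 //.
rewrite cubicE // !abs_trace4E [(b ^+ 3) ^+ 4]exprAC b4.
have : (1 + a) ^+ 3 + (1 + a) + (1 + a) ^+ 2 = 0.
  apply: (@eq_char2 _ char2 _ _ (2 + 3 * a + 2 * a ^+ 2)); rewrite subr0.
  transitivity (3 + 6 * a + 4 * a ^+ 2 + a ^+ 3); first by ring.
  by rewrite a3; ring.
move: (1 + a) b4 e4 => e b4 e4 e3.
have -> : b + (b + e) = e by apply: (@eq_char2 _ char2 _ _ b); ring.
have -> : b ^+ 3 + (b + e) ^+ 3 = b ^+ 2 * e + b * e ^+ 2 + e ^+ 3.
  by apply: (@eq_char2 _ char2 _ _ (b ^+ 3 + b ^+ 2 * e + b * e ^+ 2)); ring.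
have -> : (b ^+ 2 * e + b * e ^+ 2 + e ^+ 3) ^+ 2 = b * e ^+ 2 + b ^+ 2 * e.
  transitivity (b ^+ 4 * e ^+ 2 + b ^+ 2 * e ^+ 4 + e ^+ 4 * e ^+ 2 +
    2 * (b ^+ 3 * e ^+ 3 + b ^+ 2 * e ^+ 4 + b * e ^+ 5)); first by ring.
  rewrite b4 e4 pcharf0 // mul0r.
  by apply: (@eq_char2 _ char2 _ _ (e ^+ 3)); ring.
rewrite -[RHS]e3.
by apply: (@eq_char2 _ char2 _ _ (b ^+ 2 * e + b * e ^+ 2)); ring.
Qed.

(** Since a^3 = 1, the polar term Tr((1 + a) a^2 u^2) equals Tr(a u) + Tr(u), which exchanges Tr(a
    u) for Tr(u). *)
Lemma cubic_affine (a d u : F) : a ^+ 3 = 1 -> d ^+ 4 + d = 1 + a ->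
  cubic m (a * u + d) = cubic m u + cubic m d.
Proof.
move=> a3 d4; have MK := mem_frob_fix.
rewrite [a * u + d]addrC cubicD // d4 [RHS]addrC -addrA; congr (_ + _).
rewrite !cubicE // !exprMn a3 mul1r -addrA; congr (_ + _).
rewrite -[abs_trace m (a * u)]abs_trace_sqr // -abs_traceD //.
rewrite -[RHS]abs_trace_sqr //; congr (abs_trace m _).
transitivity (a ^+ 3 * u ^+ 2 + 2 * (a ^+ 2 * u ^+ 2)); first by ring.
by rewrite a3 pcharf0 // mul0r; ring.
Qed.

Lemma mem_B2 (x : F) : (x \in B2 F m) = (cubic m x == 1).
Proof. by rewrite inE. Qed.

Lemma cubic_sum_B2 : cubic_sum F m = 2 ^+ m - #|B2 F m|%:Z *+ 2.
Proof.
rewrite cubic_sum_count ?card_frob_fixT //; congr (_ - _%:Z *+ 2).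
by apply: eq_card => x; rewrite inE mem_frob_fix mem_B2.
Qed.

Lemma cubic_sum_4dvd (d : nat) : (0 < d)%N -> m = (d * 4)%N ->
  cubic_sum F m = - (-1) ^+ d * 2 ^+ (d * 2).+1.
Proof.
move=> d0 mE; have [|tau [x0 [tau2 x04]]] := exists_artin_schreier4.
  by rewrite mE dvdn_mull.
(* Both sides have square 2^(m+2), so the residue modulo 3 settles the sign. *)
apply: (@eq_of_sqr_eq_mod 3 (d * 4).+2) => //.
- rewrite (@cubic_sum_even_sqr (d * 2)); last 2 first.
  + by rewrite muln_gt0 d0.
  + by rewrite mE -mulnA.
  by rewrite oddM andbF mE !exprSr -mulrA.
- rewrite exprMn sqrrN -exprM mulnC exprM sqrrN !expr1n mul1r -exprM.
  congr (2 ^+ _); lia.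
have t3 := cube_root3 tau2.
have fixE : tau * x0 + (1 + tau) * x0 = x0.
  by apply: (@eq_char2 _ char2 _ _ (tau * x0)); ring.
have e4 : ((1 + tau) * x0) ^+ 4 + (1 + tau) * x0 = 1 + tau.
  rewrite exprMn (exprD_char2 char2 2) expr1n [tau ^+ _](_ : _ = tau); last first.
    by rewrite [LHS]exprS t3 mulr1.
  rewrite x04; apply: (@eq_char2 _ char2 _ _ ((1 + tau) * x0)); ring.
have b0 : cubic m ((1 + tau) * x0) = 0 by apply: (cubic_stab_const mE t3 e4).
rewrite cubic_sum_B2 rmorphB rmorphMn /=.
have F3 := pchar_Fp (isT : prime 3).
rewrite -pmulrn -(GRing.natr_mod_pchar F3).
(* This map has order 3, preserves the block and fixes only [x0], so the block size modulo 3 tells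
   whether [x0] is in the block. *)
rewrite (@card_fixpoints_mod _ 3 _ (fun x => tau * x + (1 + tau) * x0)) //; last 2 first.
- by move=> x; rewrite !mem_B2 cubic_affine // b0 addr0.
- move=> x _ /=.
  transitivity (tau ^+ 3 * x + (tau ^+ 3 - 1) * x0 +
    2 * ((tau ^+ 2 + tau + 1) * x0)); first by ring.
  by rewrite t3 pcharf0 // mul0r; ring.
have -> : [set x in B2 F m | tau * x + (1 + tau) * x0 == x] =
    if odd d then [set x0] else set0.
  apply/setP=> x; rewrite inE mem_B2.
  have -> : (tau * x + (1 + tau) * x0 == x) = (x == x0).
    rewrite -subr_eq0 [_ - x](_ : _ = (tau - 1) * (x - x0)).
      by rewrite mulf_eq0 !subr_eq0 (negPf (cube_root_neq1 tau2)).
    by apply: (@eq_char2 _ char2 _ _ (tau * x0)); ring.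
  have := cubic_artin_schreier mE x04; rewrite natr_char2 //.
  case: (eqVneq x x0) => [->|xx0] cx; last first.
    by rewrite andbF; case: odd; rewrite inE ?(negPf xx0).
  by rewrite cx; case: odd; rewrite inE ?eqxx // eq_sym oner_eq0.
rewrite (GRing.natr_mod_pchar F3) rmorphM rmorphN !rmorphXn /=.
have -> : (2%:~R : 'F_3) = -1 by apply: val_inj.
rewrite -(signr_odd _ m) -(signr_odd _ (d * 2).+1) -(signr_odd _ d) mE /= !oddM !andbF /=.
by case: odd; rewrite ?cards1 ?cards0; apply: val_inj.
Qed.

End Even.

(** * Orbits of the affine group *)

Section AffineOrbit.

Variables (F : finFieldType) (B : {set F}).

(** The pair (a, b) stands for x -> a x + b, so that group elements are counted and composed by
    coordinates. *)
Definition affine_image (p : F * F) : {set F} := [set p.1 * u + p.2 | u in B].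

Definition affine_pairs : {set F * F} := [set p | p.1 != 0].

Definition affine_stab : {set F * F} := [set p in affine_pairs | affine_image p == B].

Lemma mem_affine_image (p : F * F) (x : F) : p.1 != 0 ->
  (x \in affine_image p) = ((x - p.2) / p.1 \in B).
Proof.
move=> p0; apply/imsetP/idP => [[u uB ->]|xB]; first by rewrite addrK mulrC mulKf.
by exists ((x - p.2) / p.1); rewrite // mulrC divfK // subrK.
Qed.

Lemma affine_imageE (p : F * F) (u : F) : p.1 != 0 ->
  (p.1 * u + p.2 \in affine_image p) = (u \in B).
Proof. by move=> p0; rewrite mem_affine_image // addrK mulrC mulKf. Qed.

Lemma card_affine_image (p : F * F) : p.1 != 0 -> #|affine_image p| = #|B|.
Proof. by move=> p0; apply: card_imset => u v /addIr /(mulfI p0). Qed.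

Lemma affine_stabP (p : F * F) :
  reflect (p.1 != 0 /\ forall u, (p.1 * u + p.2 \in B) = (u \in B)) (p \in affine_stab).
Proof.
rewrite !inE; apply: (iffP andP) => -[p0].
  by move=> /eqP pB; split=> // u; rewrite -{1}pB affine_imageE.
move=> pB; split=> //; apply/eqP/setP=> x; rewrite mem_affine_image // -pB.
by rewrite mulrC divfK // subrK.
Qed.

(** The maps that carry [B] to the same block as p form the coset of the stabilizer by p. *)
Lemma card_affine_fiber (p : F * F) : p.1 != 0 ->
  #|[set q in affine_pairs | affine_image q == affine_image p]| = #|affine_stab|.
Proof.
move=> p0; pose f (c : F * F) := (p.1 * c.1, p.1 * c.2 + p.2).
have f_inj : injective f.
  by move=> [c d] [c' d'] [] /(mulfI p0) -> /addIr /(mulfI p0) ->.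
rewrite -[RHS](card_imset _ f_inj); apply: eq_card => q.
rewrite !inE; apply/andP/imsetP => [[q0 /eqP qp]|[c /affine_stabP[c0 cB] ->]].
  exists (q.1 / p.1, (q.2 - p.2) / p.1); last first.
    by rewrite /f /= ![p.1 * _]mulrC !divfK // subrK -surjective_pairing.
  apply/affine_stabP; split; first by rewrite mulf_neq0 ?invr_eq0.
  move=> u /=; rewrite -(affine_imageE u q0) qp mem_affine_image //.
  by congr (_ \in B); field.
split; first by rewrite mulf_neq0.
apply/eqP/setP=> x; rewrite !mem_affine_image ?mulf_neq0 // -[LHS]cB.
by congr (_ \in B); rewrite /=; field; rewrite p0.
Qed.

(** Sharp 2-transitivity: sending a map to the preimages of x and y is a bijection onto the ordered
    pairs of distinct points of [B]. *)
Lemma card_affine_cover (x y : F) : x != y ->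
  #|[set p in affine_pairs | [set x; y] \subset affine_image p]| = (#|B| * #|B|.-1)%N.
Proof.
move=> xy; pose f (p : F * F) := ((x - p.2) / p.1, (y - p.2) / p.1).
have -> : (#|B| * #|B|.-1)%N = #|[set q in setX B B | q.1 != q.2]|.
  have := cardsID [set q | q.1 == q.2] (setX B B); rewrite cardsX.
  have -> : setX B B :&: [set q | q.1 == q.2] = [set (u, u) | u in B].
    apply/setP=> -[u v]; rewrite !inE /=; apply/andP/imsetP => [[/andP[uB _] /eqP<-]|].
      by exists u.
    by case=> w wB [-> ->]; rewrite wB eqxx.
  rewrite card_imset; last by move=> u v [].
  rewrite (_ : setX B B :\: _ = [set q in setX B B | q.1 != q.2]); last first.
    by apply/setP=> q; rewrite !inE andbC.
  by rewrite -subn1 mulnBr muln1 => <-; rewrite addKn.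
rewrite -[LHS](card_in_imset (f := f)); last first.
  move=> [a b] [a' b']; rewrite !inE /= => /andP[a0 _] /andP[a0' _] [e1 e2].
  have e3 : (x - y) / a = (x - y) / a'.
    have sub c : x - y = x - c - (y - c) by ring.
    by rewrite {1}(sub b) {1}(sub b') [LHS]mulrBl [RHS]mulrBl e1 e2.
  have aa' : a = a' by apply: invr_inj; apply: mulfI e3; rewrite subr_eq0.
  have ai0 : a^-1 != 0 by rewrite invr_eq0.
  by rewrite -aa' in e1 *; have /addrI /oppr_inj -> := mulIf ai0 e1.
apply: eq_card => -[u v]; apply/imsetP/idP.
  case=> p; rewrite !inE subUset !sub1set => /andP[p0].
  rewrite !mem_affine_image // => /andP[xB yB] [-> ->] /=; rewrite xB yB /=.
  by rewrite (inj_eq (mulIf _)) ?invr_eq0 // (inj_eq (addIr _)).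
rewrite !inE /= => /andP[/andP[uB vB] uv].
have uv0 : u - v != 0 by rewrite subr_eq0.
have xy0 : x - y != 0 by rewrite subr_eq0.
(* The only affine map with u -> x and v -> y has slope a and constant term x - a u. *)
pose a := (x - y) / (u - v); have a0 : a != 0 by rewrite mulf_neq0 ?invr_eq0.
have e1 : (x - (x - a * u)) / a = u by rewrite opprB addrC subrK mulrC mulKf.
have e2 : (y - (x - a * u)) / a = v.
  have -> : y - (x - a * u) = a * v.
    have : a * (u - v) = x - y by rewrite divfK.
    by rewrite mulrBr => e; rewrite opprB addrCA -opprB -e opprB addrC subrK.
  by rewrite mulrC mulKf.
exists (a, x - a * u); last by rewrite /f /= e1 e2.
by rewrite !inE subUset !sub1set !mem_affine_image //= e1 e2 uB vB a0.
Qed.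

(** The maps whose image of [B] contains x and y are grouped by that image; each group has as many
    elements as the stabilizer. *)
Lemma affine_orbit_design (x y : F) : x != y ->
  (#|[set C in affine_image @: affine_pairs | [set x; y] \subset C]| * #|affine_stab|
    = #|B| * #|B|.-1)%N.
Proof.
move=> xy; rewrite -(card_affine_cover xy) -[RHS]sum1_card.
rewrite (partition_big affine_image
  (fun C => C \in [set C in affine_image @: affine_pairs | [set x; y] \subset C])) /=.
  rewrite -sum_nat_const; apply: eq_bigr => C; rewrite inE => /andP[/imsetP[p]].
  rewrite inE => p0 -> sub; rewrite sum1_card -(card_affine_fiber p0).
  apply: eq_card => q; rewrite !inE unfold_in /= !inE.
  by case: (eqVneq (affine_image q)) => [->|]; rewrite ?sub ?andbT ?andbF.
by move=> p; rewrite !inE => /andP[p0 ->]; rewrite andbT imset_f // inE.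
Qed.

End AffineOrbit.

(** * The stabilizer of the base block *)

Section Stabilizer.

Variables (F : finFieldType) (m : nat) (m_gt0 : (0 < m)%N) (cF : #|F| = (2 ^ m)%N).
Let char2 := char2_of_card cF.
Let MK := mem_frob_fix cF.

Lemma abs_trace_sqr_nondeg (c : F) : (forall v, abs_trace m (c * v ^+ 2) = 0) -> c = 0.
Proof.
move=> h; apply/eqP; apply: contraT => c0.
have [d _ dc] := frob_fix_sqrt m_gt0 (MK c).
have d0 : d != 0 by apply: contraNneq c0 => d0; rewrite -dc d0 expr0n.
have [y _ y1] := abs_trace_nondeg char2 m_gt0 (card_frob_fixT cF) (MK d) d0.
by have := h y; rewrite -dc -exprMn abs_trace_sqr // y1 => /eqP; rewrite oner_eq0.
Qed.

Lemma affine_stab_B2 (p : F * F) : (p \in affine_stab (B2 F m)) =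
  [&& p.1 ^+ 3 == 1, p.2 ^+ 4 + p.2 == 1 + p.1 & cubic m p.2 == 0].
Proof.
case: p => a d /=; apply/affine_stabP/and3P => /= [[a0 inv]|[/eqP a3 /eqP d4 /eqP dQ]].
  have {}inv u : cubic m (a * u + d) = cubic m u.
    have := inv u; rewrite !mem_B2.
    case/orP: (cubic01 char2 (MK u)) => /eqP ->;
    case/orP: (cubic01 char2 (MK (a * u + d))) => /eqP -> //;
    by rewrite ?eqxx eq_sym oner_eq0.
  have d0 : cubic m d = 0 by have := inv 0; rewrite mulr0 add0r cubic_0.
  (* Both sides of Q(a (u + v) + d) = Q(u + v) are expanded by polarization. *)
  have pol u v : cubic m v + abs_trace m ((u ^+ 4 + u) * v ^+ 2) =
      cubic m (a * v) + abs_trace m (((a * u + d) ^+ 4 + (a * u + d)) * (a * v) ^+ 2).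
    have e1 := cubicD char2 (MK u) (MK v).
    have := cubicD char2 (MK (a * u + d)) (MK (a * v)); rewrite inv => e2.
    apply: (addrI (cubic m u)); rewrite [LHS]addrA [RHS]addrA -e1 -e2 -(inv (u + v)).
    by congr (cubic m _); ring.
  have pol0 v : cubic m v = cubic m (a * v) + abs_trace m ((d ^+ 4 + d) * (a * v) ^+ 2).
    by have := pol 0 v; rewrite expr0n mulr0 !add0r mul0r abs_trace0 addr0.
  have add4 x y : (x + y) ^+ 4 = x ^+ 4 + y ^+ 4 :> F by apply: (exprD_char2 char2 2).
  (* Comparison with the case u = 0 removes Q(v) and Q(a v) and leaves the trace of a constant times
     v^2, zero for every v; by nondegeneracy the constant is zero. *)
  have quad u : (a ^+ 3 + 1) ^+ 2 * u ^+ 4 + (a ^+ 3 + 1) * u = 0.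
    apply: abs_trace_sqr_nondeg => v.
    have := pol u v; rewrite pol0 -addrA => /addrI.
    rewrite -abs_traceD // => /eqP.
    rewrite -subr_eq0 oppr_pchar2 // -abs_traceD // => /eqP.
    apply: etrans; congr (abs_trace m _); rewrite add4.
    apply: (@eq_char2 _ char2 _ _
      ((a ^+ 3 * u ^+ 4 - (d ^+ 4 + d) * a ^+ 2) * v ^+ 2)); ring.
  (* At u = 1, with A = a^3 + 1, the identity reads A (A + 1) = A a^3 = 0. *)
  have a3 : a ^+ 3 = 1.
    apply/eqP; rewrite -subr_eq0 oppr_pchar2 //; apply: contraT => al0.
    have := quad 1; rewrite !expr1n !mulr1 expr2.
    have -> : (a ^+ 3 + 1) * (a ^+ 3 + 1) + (a ^+ 3 + 1) =
      (a ^+ 3 + 1) * (a ^+ 3 + 2) by ring.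
    rewrite pcharf0 // addr0 => /eqP; rewrite mulf_eq0 (negPf al0) expf_eq0.
    by rewrite (negPf a0).
  split; rewrite ?a3 ?d0 //.
  (* Now that a^3 = 1, the cubes in [pol0] cancel; the remaining relation, multiplied by a, is the
     condition on d. *)
  have : (1 + a ^+ 2 + (d ^+ 4 + d) * a ^+ 2) = 0.
    apply: abs_trace_sqr_nondeg => v; have := pol0 v.
    rewrite !cubicE // exprMn a3 mul1r -addrA => /addrI.
    rewrite -[abs_trace m v]abs_trace_sqr // -[abs_trace m (a * v)]abs_trace_sqr //.
    rewrite -abs_traceD // => /eqP.
    rewrite -subr_eq0 oppr_pchar2 // -abs_traceD // => /eqP.
    by apply: etrans; congr (abs_trace m _); ring.
  move/(congr1 (fun x => a * x)); rewrite mulr0 => e.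
  rewrite -subr_eq0 -e; apply/eqP; apply: (@eq_char2 _ char2 _ _ (- a - 1)).
  transitivity ((d ^+ 4 + d) * (1 - a ^+ 3) - a ^+ 3 - 1 - 2 * a + (1 - 1)); first by ring.
  by rewrite a3; ring.
split; first by apply: contra_eq_neq a3 => ->; rewrite expr0n eq_sym oner_eq0.
by move=> u; rewrite !mem_B2 cubic_affine // dQ addr0.
Qed.

(** The slope a runs over the 3 nonzero elements of GF(4), and for each a the solutions of b^4 + b =
    1 + a form the translate of GF(4) by (1 + a) x0. *)
Lemma card_stab_4dvd : (4 %| m)%N -> #|affine_stab (B2 F m)| = 12.
Proof.
move=> m4; have [d mE] := dvdnP m4.
have [tau [x0 [tau2 x04]]] := exists_artin_schreier4 cF m4.
pose G := [set w : F | w ^+ 4 == w].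
have cG : #|G| = 4 := card_gf4 cF tau2.
pose f (q : F * F) := (q.1, q.2 + (1 + q.1) * x0).
have f_inj : injective f by move=> [a c] [a' c'] [->] /addIr ->.
have aff4 a b : a ^+ 3 = 1 -> (b + (1 + a) * x0) ^+ 4 = b ^+ 4 + (1 + a) * (x0 + 1).
  move=> a3; rewrite !(exprD_char2 char2 2) exprMn (exprD_char2 char2 2) x04.
  by rewrite expr1n [a ^+ _]exprS a3 mulr1.
have -> : affine_stab (B2 F m) = f @: setX (G :\ 0) G.
  apply/setP=> -[a b]; rewrite affine_stab_B2 /=; apply/and3P/imsetP.
    case=> /eqP a3 /eqP b4 _.
    have b4' : b ^+ 4 = b + (1 + a) by rewrite -b4 addrCA addrr_pchar2 ?addr0.
    exists (a, b - (1 + a) * x0); last by rewrite /f subrK.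
    rewrite !inE /= -andbA; apply/and3P; split.
    - by apply: contra_eq_neq a3 => ->; rewrite expr0n eq_sym oner_eq0.
    - by rewrite exprS a3 mulr1.
    rewrite oppr_pchar2 // (aff4 _ _ a3) b4'.
    by apply/eqP; apply: (@eq_char2 _ char2 _ _ (1 + a)); ring.
  case=> -[a' c]; rewrite !inE /= => /andP[/andP[a0 /eqP a4] /eqP c4] [-> ->].
  have a3 : a' ^+ 3 = 1 by apply: (mulfI a0); rewrite -exprS mulr1.
  have e4 : (c + (1 + a') * x0) ^+ 4 + (c + (1 + a') * x0) = 1 + a'.
    rewrite (aff4 _ _ a3) c4.
    by apply: (@eq_char2 _ char2 _ _ (c + (1 + a') * x0)); ring.
  by split; rewrite ?a3 ?e4 // (cubic_stab_const cF mE a3 e4).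
rewrite card_imset // cardsX cG; have := cardsD1 0 G; rewrite cG inE expr0n eqxx add1n.
by move=> [<-].
Qed.

Lemma card_stab_n4dvd : ~~ (4 %| m)%N -> #|affine_stab (B2 F m)| = 2.
Proof.
move=> m4.
have -> : affine_stab (B2 F m) = [set (1, 0); (1, 1)].
  apply/setP=> -[a b]; rewrite affine_stab_B2 !inE /= !xpair_eqE.
  apply/and3P/orP => [[/eqP a3 /eqP b4 /eqP bQ]|]; last first.
    case=> /andP[/eqP-> /eqP->]; last by rewrite cubic_1 !expr1n !eqxx; split.
    by rewrite cubic_0 expr1n expr0n add0r addrr_pchar2 // !eqxx; split.
  have a4 : a ^+ 4 = a by rewrite exprS a3 mulr1.
  have a0 : a == 0 = false.
    by apply/negbTE; apply: contra_eq_neq a3 => ->; rewrite expr0n eq_sym oner_eq0.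
  have b4' : b ^+ 4 = b + (1 + a) by rewrite -b4 addrCA addrr_pchar2 ?addr0.
  (* For m odd, GF(4) meets [F] only in GF(2). For m = 2 modulo 4, b lies in GF(16) and in GF(2^m),
     hence in GF(4), so b^4 = b and 1 + a = 0. *)
  have a1 : a = 1.
    have [om|em] := boolP (odd m).
      by have := frob_fix4_odd om (MK a) a4; rewrite a0 => /eqP.
    have b16 : b \in frob_fix F 4.
      by apply: mem_gf16 cF _ _ b4' _; rewrite (exprD_char2 char2 2) a4 expr1n.
    have mE : m = ((m %/ 4) * 4 + 2)%N by lia.
    have := frob_fix_mul (m %/ 4) b16 => /frob_fixP b16'.
    have : b ^+ 4 = b.
      by move/frob_fixP: (MK b); rewrite {1}mE expnD exprM b16'.
    rewrite b4' -{2}[b]addr0 => /addrI /eqP; rewrite addrC addr_eq0 oppr_pchar2 //.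
    by move/eqP.
  rewrite a1 eqxx /=; apply/orP; rewrite -[b == 1]subr_eq0 -mulf_eq0.
  have [om|em] := boolP (odd m).
    rewrite mulf_eq0 subr_eq0; apply: (frob_fix4_odd om (MK b)).
    by rewrite b4' a1 addrr_pchar2 // addr0.
  (* An element b of GF(4) outside GF(2) would have Q(b) = 1, because m/2 is odd. *)
  apply: contraT => bb0.
  have b2 : b ^+ 2 = b + 1.
    apply/eqP; rewrite -subr_eq0 -(mulrI_eq0 _ (mulfI bb0)); apply/eqP.
    apply: (@eq_char2 _ char2 _ _ (b - b ^+ 3)).
    transitivity (b ^+ 4 - b + 2 * (b - b ^+ 3)); first by ring.
    by rewrite b4' a1 addrr_pchar2 // addr0; ring.
  have mE : m = (m./2 * 2)%N by lia.
  have := cubic_cube_root cF b2 mE; rewrite bQ natr_char2 // => /esym/eqP.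
  by rewrite (_ : odd m./2) ?oner_eq0 //; lia.
by rewrite cards2 xpair_eqE eqxx eq_sym oner_eq0.
Qed.

End Stabilizer.

(** * Block size and design parameters *)

(** The evaluations of S become block sizes through S = 2^m - 2k. *)
Lemma card_B2 (F : finFieldType) (m : nat) : (0 < m)%N -> #|F| = (2 ^ m)%N ->
  #|B2 F m|%:Z = block_size m.
Proof.
move=> m0 cF; have := cubic_sum_B2 cF.
have pow2 : 2 ^+ m = 2 ^+ m.-1 *+ 2 :> int by rewrite -{1}(prednK m0) exprS mulr_natl.
rewrite pow2 /block_size modn2; case: (boolP (odd m)) => om /=.
  rewrite (cubic_sum_odd cF om (dvdnn m)) [m.+1./2](_ : _ = (m.-1 %/ 2).+1); last by lia.
  by rewrite exprS mulrCA; move: (jacobi 2 m * _) (2 ^+ m.-1) => x y e; lia.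
have [d0 mE] : (0 < m./2)%N /\ m = (m./2 * 2)%N by lia.
case: ifP => [m4|m4].
  have [d1 dE] : (0 < m %/ 4)%N /\ m = (m %/ 4 * 4)%N by lia.
  rewrite (cubic_sum_4dvd cF d1 dE) (_ : m %/ 4 * 2 = m %/ 2)%N; last by lia.
  rewrite exprS mulrCA mulNr; move: (_ * 2 ^+ (m %/ 2)) (2 ^+ m.-1) => x y e; lia.
move/eqP: (cubic_sum_even_sqr cF d0 mE); rewrite (_ : odd m./2); last by lia.
rewrite mulr0 sqrf_eq0 => /eqP->; move: (_ ^+ _) => x e; lia.
Qed.

Lemma blocks2E (F : finFieldType) (m : nat) :
  blocks2 F m = affine_image (B2 F m) @: affine_pairs F.
Proof.
apply/setP=> C; apply/imsetP/imsetP => [[g]|[p]].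
  rewrite inE => /existsP[a /existsP[b /andP[a0 /eqP->]]] ->.
  exists (a, b); first by rewrite inE.
  by apply: eq_imset => u; rewrite ffunE.
rewrite inE => p0 ->; exists [ffun x => p.1 * x + p.2].
  by rewrite inE; apply/existsP; exists p.1; apply/existsP; exists p.2; rewrite p0 eqxx.
by apply: eq_imset => u; rewrite ffunE.
Qed.

Theorem theorem21 (m : nat) (F : finFieldType)
    (hm : (3 <= m)%N) (hF : #|F| = (2 ^ m)%N) :
  exists k lambda : nat,
    [/\ k%:Z = block_size m,
        lambda%:R = design_lambda m k
      & is_design 2 (2 ^ m) k lambda [set: F] (blocks2 F m)].
Proof.
have m0 : (0 < m)%N by apply: leq_trans hm.
pose s := if (m %% 4 == 0)%N then 12%N else 2%N.
have s0 : (0 < s)%N by rewrite /s; case: ifP.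
have stab : #|affine_stab (B2 F m)| = s.
  rewrite /s; case: ifP => m4; first exact: card_stab_4dvd.
  by apply: card_stab_n4dvd; rewrite // /dvdn m4.
pose k := #|B2 F m|.
have design (x y : F) : x != y ->
    (#|[set C in blocks2 F m | [set x; y] \subset C]| * s = k * k.-1)%N.
  by move=> xy; rewrite blocks2E -stab affine_orbit_design.
(* The pair 0, 1 serves as reference: multiplied by s, the count of every pair is k (k - 1). *)
pose lambda := #|[set C in blocks2 F m | [set 0; 1] \subset C]|.
have lambdaE : (lambda * s = k * k.-1)%N by rewrite design // eq_sym oner_neq0.
exists k, lambda; split; first exact: card_B2.
  have : lambda%:R * s%:R = k%:R * (k%:R - 1) :> rat.
    (* For k = 0 the truncated predecessor is 0 and not -1, but both products vanish. *)
    rewrite -natrM lambdaE; case: (k) => [|j]; first by rewrite mul0n mul0r.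
    by rewrite natrM -[X in _ = _ * (X - 1)]natr1 addrK.
  rewrite /design_lambda => <-; by rewrite /s; case: (m %% 4 == 0)%N; rewrite mulfK.
split; first by rewrite cardsT.
  move=> C; rewrite blocks2E subsetT => /imsetP[p]; rewrite inE => p0 ->.
  by rewrite card_affine_image.
move=> S _ /eqP/cards2P[x [y [xy ->]]].
by apply/eqP; rewrite -(eqn_pmul2r s0) lambdaE; apply/eqP/design.
Qed.
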